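(* Let $\boldsymbol\Lambda\in\mathbb R^{N\times N}$ be such that $\ker(\boldsymbol\Lambda)=\operatorname{span}(\mathbf v_1,\dots,\mathbf v_k)$ is a $k$-dimensional subspace of $\mathbb R^N$ with $k>0$. Let $\mathbf y^*\in\ker(\boldsymbol\Lambda)$ be a fixed point of $\mathbf g\colon D\to D$, where $D\subseteq\mathbb R^N$ contains a neighborhood $\mathcal D$ of $\mathbf y^*$. Moreover, let every element of $C=\ker(\boldsymbol\Lambda)\cap\mathcal D$ be a fixed point of $\mathbf g$, and suppose that $\mathbf g|_{\mathcal D}\in\mathcal C^1$ and that the first derivatives of $\mathbf g$ are Lipschitz continuous on $\mathcal D$. Then $\mathbf D\mathbf g(\mathbf y^* )\mathbf v_i=\mathbf v_i$ for $i=1,\dots,k$, and the following statements hold. (a) If the remaining $N-k$ eigenvalues of $\mathbf D\mathbf g(\mathbf y^* )$ have absolute values smaller than $1$, then $\mathbf y^*$ is a stable fixed point of $\mathbf g$. (b) Let $H=\{\mathbf y\in\mathbb R^N\mid \mathbf N\mathbf y=\mathbf N\mathbf y^*\}$ and let $\mathbf g$ conserve all linear invariants, so that in particular $\mathbf g(\mathbf y)\in H\cap D$ for all $\mathbf y\in H\cap D$. If additionally the assumption of (a) is satisfied, then there exists $\delta>0$ such that $\mathbf y^0\in H\cap D$ and $\|\mathbf y^0-\mathbf y^*\|<\delta$ imply $\mathbf y^n\to\mathbf y^*$ as $n\to\infty$, where $\mathbf y^{n+1}=\mathbf g(\mathbf y^n)$.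
   Context: $\mathbf D\mathbf g$ is the Jacobian, $\|\cdot\|$ is any norm on $\mathbb R^N$, and eigenvalues are counted with algebraic multiplicity (the ''remaining'' ones are those besides the $k$ copies of the eigenvalue $1$ coming from $\mathbf v_1,\dots,\mathbf v_k$). $\mathbf N\in\mathbb R^{k\times N}$ is the matrix with rows $\mathbf n_1^T,\dots,\mathbf n_k^T$, where $\mathbf n_1,\dots,\mathbf n_k$ is a basis of $\ker(\boldsymbol\Lambda^T)$. The map $\mathbf g$ conserves all linear invariants (of $\boldsymbol\Lambda$) if $\mathbf n^T\mathbf g(\mathbf y)=\mathbf n^T\mathbf y$ for all $\mathbf y\in D$ whenever $\mathbf n^T\boldsymbol\Lambda=\mathbf 0$. A fixed point $\mathbf y^*$ of the iteration $\mathbf y^{n+1}=\mathbf g(\mathbf y^n)$ is (Lyapunov) stable if for every $\epsilon>0$ there is $\delta>0$ such that $\|\mathbf y^0-\mathbf y^*\|<\delta$ implies $\|\mathbf y^n-\mathbf y^*\|<\epsilon$ for all $n\ge0$. *)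

(* Defs.v *)
From HB Require Import structures.
From mathcomp Require Import all_boot all_order all_algebra.
From mathcomp Require Import complex.
From mathcomp Require Import all_classical all_reals all_analysis.
Set Implicit Arguments.
Unset Strict Implicit.
Unset Printing Implicit Defensive.
Import Order.TTheory GRing.Theory Num.Theory.
Import numFieldNormedType.Exports.
Local Open Scope classical_set_scope.
Local Open Scope complex_scope.
Local Open Scope ring_scope.

(* Elements of R^N are column vectors 'cV[R]_N; their canonical topology and
   normed structure are those of the max norm. *)

Definition mxker (R : realType) (m n : nat) (A : 'M[R]_(m, n))
  : {vspace 'cV[R]_n} := lker (linfun (mulmx A)).

Lemma mem_mxker (R : realType) (m n : nat) (A : 'M[R]_(m, n)) (y : 'cV[R]_n) :
  (y \in mxker A) = (A *m y == 0).
Proof. by rewrite memv_ker lfunE. Qed.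

Record is_norm (R : realType) (V : lmodType R) (nrm : V -> R) : Prop := IsNorm {
  norm_eq0 : forall x, nrm x = 0 -> x = 0;
  norm_triangle : forall x y, nrm (x + y) <= nrm x + nrm y;
  norm_homogeneous : forall a x, nrm (a *: x) = `|a| * nrm x }.

(* Row i, column j holds the partial derivative of the i-th component of g in
   the j-th coordinate direction.  The library's [jacobian] is the transpose of
   this matrix and acts on row vectors. *)
Definition jac (R : realType) (N : nat) (g : 'cV[R]_N -> 'cV[R]_N)
    (y : 'cV[R]_N) : 'M[R]_N :=
  \matrix_(i, j) ('D_(delta_mx j 0) g y) i 0.

(* To be used for open U only. *)
Definition C1_on (R : realType) (N : nat) (U : set 'cV[R]_N)
    (g : 'cV[R]_N -> 'cV[R]_N) : Prop :=
  (forall y, U y -> differentiable g y) /\ {within U, continuous (jac g)}.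

(* s lists the complex eigenvalues of the real matrix A, each repeated
   according to its algebraic multiplicity. *)
Definition is_spectrum (R : realType) (N : nat) (A : 'M[R]_N) (s : seq R[i])
  : Prop :=
  char_poly (map_mx (real_complex R) A) = \prod_(z <- s) ('X - z%:P).

Definition remaining_eigenvalues_lt1 (R : realType) (N k : nat) (A : 'M[R]_N)
  : Prop :=
  exists2 r : seq R[i],
    is_spectrum A (nseq k 1 ++ r) & {in r, forall z, `|z| < 1}.

Definition stable_fixed_point (R : realType) (N : nat) (nrm : 'cV[R]_N -> R)
    (D : set 'cV[R]_N) (g : 'cV[R]_N -> 'cV[R]_N) (ystar : 'cV[R]_N) : Prop :=
  g ystar = ystar /\
  forall eps : R, 0 < eps -> exists2 delta : R, 0 < delta &
    forall y0, D y0 -> nrm (y0 - ystar) < delta ->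
      forall n : nat, nrm (iter n g y0 - ystar) < eps.

Definition conserves_linear_invariants (R : realType) (N : nat)
    (Lambda : 'M[R]_N) (D : set 'cV[R]_N) (g : 'cV[R]_N -> 'cV[R]_N) : Prop :=
  forall n : 'cV[R]_N, n^T *m Lambda = 0 ->
    forall y, D y -> n^T *m g y = n^T *m y.

Definition mx_of_rows (R : realType) (N k : nat) (n : k.-tuple 'cV[R]_N)
  : 'M[R]_(k, N) := \matrix_(i < k) (tnth n i)^T.

Definition invariant_set (R : realType) (N k : nat) (n : k.-tuple 'cV[R]_N)
    (ystar : 'cV[R]_N) : set 'cV[R]_N :=
  [set y | mx_of_rows n *m y = mx_of_rows n *m ystar].

(* Main.v *)
Require Import Defs.
From HB Require Import structures.
From mathcomp Require Import all_boot all_order all_algebra.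
From mathcomp Require Import complex ring lra.
From mathcomp Require Import all_classical all_reals all_analysis.
Set Implicit Arguments.
Unset Strict Implicit.
Unset Printing Implicit Defensive.
Import Order.TTheory GRing.Theory Num.Theory.
Import numFieldNormedType.Exports.
Local Open Scope classical_set_scope.
Local Open Scope ring_scope.

(** The derivative of [g] at [ystar] fixes every vector of the kernel of
[Lambda], because near [ystar] that kernel consists of fixed points. Let [P]
be a surjective matrix with the same kernel as [Lambda], let [U] be a right
inverse of [P], and let [A] be the Jacobian matrix at [ystar]. Then [A] induces
[C = P A U] on the quotient by the kernel, and a determinant identity
([char_poly_quotient]) shows that the eigenvalues of [C] are the remaining
eigenvalues of [A], with their multiplicities. They have modulus less than
one, so [C] is a strict contraction for a suitable norm
([contracting_norm]).

For a small [z] the point [ystar + (z - U P z)] is fixed, and comparing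
[g (ystar + z)] with it by strict differentiability
([C1_strictly_differentiable]) gives
[g (ystar + z) - ystar = z + (A - 1) U P z + e], where [e] is small compared
with [P z]. Hence [P z] contracts geometrically, while each step moves [z] by
at most a multiple of [P z] ([quotient_contraction]). The total displacement is
a geometric series, so the orbit stays close to [ystar] ([orbit_bound]); this
is stability.

If the linear invariants are conserved, differentiating the conservation law
shows that the left kernel of [Lambda] is fixed by [A], so that [Lambda] and
[A - 1] have the same column space. A displacement [z] within the level set of
the invariants lies in that space, on which [z] is a linear function of [P z]
([invariants_determined]). As [P z] tends to zero along the orbit, so does
[z]. *)

(** * Matrix norms *)

Lemma ler_entry_mx_norm (K : numDomainType) m n (x : 'M[K]_(m, n)) i j :
  `|x i j| <= `|x|.
Proof.
rewrite [leRHS]/Num.norm /= mx_normE.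
have: (`|x (i, j).1 (i, j).2|%:nng <=
       \big[Order.max/0%:nng]_ij `|x ij.1 ij.2|%:nng :> {nonneg K})%O.
  exact: (le_bigmax 0%:nng (fun ij : 'I_m * 'I_n => `|x ij.1 ij.2|%:nng)).
by rewrite -num_le.
Qed.

Lemma mx_norm_ler (K : numDomainType) m n (x : 'M[K]_(m, n)) (e : K) :
  0 <= e -> (forall i j, `|x i j| <= e) -> `|x| <= e.
Proof.
move=> e0 xe; rewrite [leLHS]/Num.norm /= mx_normE.
rewrite -[leRHS]/((NngNum e0)%:num) num_le.
by apply/bigmax_leP; split => // -[i j] _; rewrite -num_le /= xe.
Qed.

Lemma mx_norm_mulmx (K : numDomainType) m n p
    (A : 'M[K]_(m, n)) (B : 'M[K]_(n, p)) :
  `|A *m B| <= n%:R * `|A| * `|B|.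
Proof.
apply: mx_norm_ler => [|i j]; first by rewrite !mulr_ge0.
rewrite mxE (le_trans (ler_norm_sum _ _ _))//.
apply: (@le_trans _ _ (\sum_(l < n) `|A| * `|B|)).
  apply: ler_sum => l _; rewrite normrM.
  by apply: ler_pM => //; exact: ler_entry_mx_norm.
by rewrite sumr_const card_ord -mulrA mulr_natl.
Qed.

Lemma trmx_continuous (K : numFieldType) m n :
  continuous (trmx : 'M[K]_(m, n) -> 'M[K]_(n, m)).
Proof.
move=> x s /= /(nbhs_ballP x^T) [e e0 es].
apply/nbhs_ballP; exists e => //= y [_ xy]; apply: es; split=> // i j.
by rewrite !mxE; exact: xy.
Qed.

Section norm_equivalence.
Context (R : realType) (N : nat) (nrm : 'cV[R]_N -> R) (nrmP : is_norm nrm).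

Lemma is_norm0 : nrm 0 = 0.
Proof. by rewrite -(scale0r 0) (norm_homogeneous nrmP) normr0 mul0r. Qed.

Lemma is_normN x : nrm (- x) = nrm x.
Proof.
by rewrite -scaleN1r (norm_homogeneous nrmP) normrN normr1 mul1r.
Qed.

Lemma is_norm_ge0 x : 0 <= nrm x.
Proof.
have := norm_triangle nrmP x (- x).
by rewrite subrr is_norm0 is_normN -mulr2n pmulrn_lge0.
Qed.

Lemma is_norm_sum (I : Type) (s : seq I) (F : I -> 'cV[R]_N) :
  nrm (\sum_(i <- s) F i) <= \sum_(i <- s) nrm (F i).
Proof.
elim/big_rec2: _ => [|i y1 y2 _ le12]; first by rewrite is_norm0.
by rewrite (le_trans (norm_triangle nrmP _ _))// lerD2l.
Qed.

Lemma is_norm_le_mx_norm : exists2 K : R, 0 < K & forall x, nrm x <= K * `|x|.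
Proof.
exists (1 + \sum_(i < N) nrm (delta_mx i 0)).
  by rewrite ltr_pwDl ?ltr01// sumr_ge0// => i _; exact: is_norm_ge0.
move=> x; rewrite mulrDl mul1r ler_wpDl// mulr_suml.
rewrite [in leLHS](matrix_sum_delta x) (le_trans (is_norm_sum _ _))//.
apply: ler_sum => i _; rewrite big_ord1 (norm_homogeneous nrmP) mulrC.
by rewrite ler_wpM2l ?is_norm_ge0 ?ler_entry_mx_norm.
Qed.

(** The minimum of the given norm over the unit sphere of the maximum norm is
attained, by compactness, and is positive, since a norm vanishes only at the
origin. *)
Lemma mx_norm_le_is_norm : exists2 K : R, 0 < K & forall x, `|x| <= K * nrm x.
Proof.
have [K K0 nK] := is_norm_le_mx_norm.
pose S := [set x : 'rV[R]_N | `|x| = 1].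
have normT (x : 'cV[R]_N) : `|x^T| = `|x|.
  apply/eqP; rewrite eq_le; apply/andP; split; apply: mx_norm_ler => // i j.
    by rewrite mxE ler_entry_mx_norm.
  by have := ler_entry_mx_norm x^T j i; rewrite mxE.
have [S0|/set0P S0] := eqVneq S set0.
  exists 1 => // x; have [->|x0] := eqVneq x 0.
    by rewrite normr0 mul1r is_norm_ge0.
  suff : S (`|x|^-1 *: x^T) by rewrite S0.
  by rewrite /S /= normrZ normfV normr_id normT mulVf ?normr_eq0.
have cS : compact S.
  apply: bounded_closed_compact.
    by exists 1; split => // t t1 x /= ->; exact: ltW.
  rewrite (_ : S = (fun x : 'rV[R]_N => `|x|) @^-1` [set 1]) //.
  apply: preimage_closed; last exact: closed_eq.
  by move=> x _; exact: norm_continuous.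
have cn : continuous (nrm \o trmx : 'rV[R]_N -> R).
  have cnrm : continuous nrm.
    move=> x.
    apply/(@cvgrPdist_le _ _ _ (nbhs x) (nbhs_filter x)) => e e0; near=> y.
    have lip a b : nrm a - nrm b <= K * `|a - b|.
      rewrite (le_trans _ (nK _))// lerBlDr.
      by rewrite -[in leLHS](subrK b a); exact: norm_triangle.
    apply: (@le_trans _ _ (K * `|x - y|)).
      by rewrite ler_norml lip andbT lerNl opprB distrC lip.
    rewrite -ler_pdivlMl// mulrC; near: y.
    by apply: cvgr_dist_le; [exact: cvg_id|rewrite divr_gt0].
  by move=> x; apply: continuous_comp; [exact: trmx_continuous|exact: cnrm].
have [|c Sc cmin] := @compact_EVT_min _ _ (nrm \o trmx) S S0 cS.
  exact: continuous_subspaceT.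
have c0 : 0 < nrm c^T.
  rewrite lt_neqAle is_norm_ge0 andbT eq_sym; apply/eqP => /(norm_eq0 nrmP).
  move/(congr1 trmx); rewrite trmxK trmx0 => c0.
  by move: Sc; rewrite inE /S /= c0 normr0 => /esym/eqP; rewrite oner_eq0.
exists (nrm c^T)^-1; first by rewrite invr_gt0.
move=> x; have [->|x0] := eqVneq x 0.
  by rewrite normr0 mulr_ge0 ?is_norm_ge0// invr_ge0 ltW.
have nx : 0 < `|x| by rewrite normr_gt0.
have /cmin : (`|x|^-1 *: x^T) \in S.
  by rewrite inE /S /= normrZ normfV normr_id normT mulVf ?normr_eq0.
rewrite /= linearZ /= trmxK (norm_homogeneous nrmP) normfV normr_id.
by rewrite ler_pdivlMl// mulrC ler_pdivlMl.
Unshelve. all: by end_near. Qed.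

End norm_equivalence.

(** * Strict differentiability *)

Lemma jac_mulmx (R : realType) N (g : 'cV[R]_N -> 'cV[R]_N) (y d : 'cV[R]_N) :
  differentiable g y -> jac g y *m d = 'D_d g y.
Proof.
move=> gy; rewrite deriveE// [in RHS](matrix_sum_delta d) linear_sum.
apply/matrixP => i j; rewrite mxE summxE (ord1 j).
apply: eq_bigr => l _; rewrite big_ord1 linearZ /= !mxE deriveE//.
by rewrite mulrC.
Qed.

Lemma is_derive_along (R : realType) N (g : 'cV[R]_N -> 'cV[R]_N)
    (w d : 'cV[R]_N) (i : 'I_N) (t : R) :
  differentiable g (w + t *: d) ->
  is_derive t 1 (fun s : R => g (w + s *: d) i 0)
    ((jac g (w + t *: d) *m d) i 0).
Proof.
move=> gt; pose phi (s : R) := g (w + s *: d).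
have quotE : (fun h : R => h^-1 *: (phi (h *: 1 + t) - phi t)) =
    (fun h => h^-1 *: (g (h *: d + (w + t *: d)) - g (w + t *: d))).
  apply/funext => h; rewrite /phi /= scaler1 scalerDl.
  by rewrite addrCA.
have phid : derivable phi t 1.
  by have := @diff_derivable _ _ _ g (w + t *: d) d gt; rewrite /derivable -quotE.
have phiE : 'D_1 phi t = 'D_d g (w + t *: d).
  by rewrite /derive -quotE.
apply: DeriveDef; first exact: (derivable_mxP phi t 1).1.
by rewrite jac_mulmx// -phiE derive_mx// mxE.
Qed.

(** By the mean value theorem each coordinate of g u - g w is the
corresponding coordinate of J (u - w), where J is the Jacobian matrix at some
point of the segment from w to u, and J is close to its value at y by
continuity. *)
Lemma C1_strictly_differentiable (R : realType) N (U : set 'cV[R]_N)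
    (g : 'cV[R]_N -> 'cV[R]_N) (y : 'cV[R]_N) (eps : R) :
  open_nbhs y U -> C1_on U g -> 0 < eps ->
  exists2 delta : R, 0 < delta &
    forall u w, `|u - y| < delta -> `|w - y| < delta ->
      U u /\ `|g u - g w - jac g y *m (u - w)| <= eps * `|u - w|.
Proof.
move=> [oU Uy] [gdiff cjac] eps0.
pose e := eps / (N%:R + 1).
have e0 : 0 < e by rewrite divr_gt0// ltr_wpDl.
have {}cjac : {for y, continuous (jac g)}.
  by move: cjac; rewrite continuous_open_subspace//; apply; rewrite inE.
have /nbhs_ballP[d1 /= d10 d1U] : nbhs y U by exact: open_nbhs_nbhs.
move/(@cvgrPdist_lt _ _ _ (nbhs y) (nbhs_filter y)) : cjac => /(_ e e0).
move=> /nbhs_ballP[d2 /= d20 d2J].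
pose d := Num.min d1 d2.
exists d; first by rewrite lt_min d10.
move=> u w ud wd.
have inU x : `|x - y| < d -> U x.
  rewrite lt_min => /andP[xd _]; apply: d1U.
  by rewrite -ball_normE /= distrC.
have inJ x : `|x - y| < d -> `|jac g x - jac g y| < e.
  rewrite lt_min => /andP[_ xd]; rewrite distrC; apply: d2J.
  by rewrite -ball_normE /= distrC.
split; first exact: inU.
have seg (t : R) : t \in `[0, 1] -> `|w + t *: (u - w) - y| < d.
  rewrite in_itv /= => /andP[t0 t1].
  have -> : w + t *: (u - w) - y = (1 - t) *: (w - y) + t *: (u - y).
    have -> : u - w = (u - y) - (w - y) by rewrite opprB addrA subrK.
    by rewrite scalerBr scalerBl scale1r addrAC [X in _ + X]addrC addrA.
  rewrite (le_lt_trans (ler_normD _ _))// !normrZ.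
  rewrite !ger0_norm ?subr_ge0//.
  have -> : d = (1 - t) * d + t * d by rewrite -mulrDl subrK mul1r.
  have [->|t0'] := eqVneq t 0.
    by rewrite subr0 !mul1r !mul0r !addr0.
  rewrite ler_ltD//; first by rewrite ler_wpM2l ?subr_ge0// ltW.
  by rewrite ltr_pM2l// lt_neqAle eq_sym t0'.
apply: mx_norm_ler => [|i j]; first by rewrite mulr_ge0// ltW.
rewrite (ord1 j).
pose h (t : R) := g (w + t *: (u - w)) i 0.
pose h' (t : R) := (jac g (w + t *: (u - w)) *m (u - w)) i 0.
have der (t : R) : t \in `[0, 1] -> is_derive t 1 h (h' t).
  by move=> t01; apply: is_derive_along; apply: gdiff; apply: inU; apply: seg.
have der_oo (t : R) : t \in `]0, 1[%R -> is_derive t 1 h (h' t).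
  by move=> t01; apply: der; exact: subset_itv_oo_cc.
have ch : {within `[0, 1], continuous h}.
  by apply: derivable_within_continuous => t /der[].
have [c c01] := MVT_segment ler01 der_oo ch.
rewrite /h /h'.
rewrite scale1r subrKC scale0r addr0 subr0 mulr1 => gE.
have subE (a b : 'cV[R]_N) : (a - b) i 0 = a i 0 - b i 0 by rewrite !mxE.
rewrite [X in `|X|](_ : _ =
    ((jac g (w + c *: (u - w)) - jac g y) *m (u - w)) i 0); last first.
  by rewrite mulmxBl !subE gE.
apply: (le_trans (ler_entry_mx_norm _ _ _)).
apply: (le_trans (mx_norm_mulmx _ _)).
rewrite ler_wpM2r//.
apply: (@le_trans _ _ ((N%:R + 1) * e)); last first.
  by rewrite /e mulrC divfK// gt_eqF// ltr_wpDl.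
by rewrite ler_pM// ?lerDl// ltW// inJ// seg.
Qed.

(** Along the line through y in the direction d the increments of L g are
those of L itself, so both have the same derivative at y. *)
Lemma jac_invariant_direction (R : realType) N p (U : set 'cV[R]_N)
    (g : 'cV[R]_N -> 'cV[R]_N) (y d : 'cV[R]_N) (L : 'M[R]_(p, N)) :
  open_nbhs y U -> C1_on U g ->
  (forall t : R, U (y + t *: d) ->
    L *m (g (y + t *: d) - g y) = t *: (L *m d)) ->
  L *m (jac g y *m d) = L *m d.
Proof.
move=> Uy gC1 Ld; apply/esym/eqP; rewrite -subr_eq0 -normr_le0.
apply/ler_addgt0Pr => e e0; rewrite add0r.
pose K := N%:R * `|L| * `|d| + 1.
have K0 : 0 < K by rewrite ltr_wpDl// !mulr_ge0.
have [delta delta0 strict] := C1_strictly_differentiable Uy gC1 (divr_gt0 e0 K0).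
pose t := delta / (`|d| + 1).
have d1 : 0 < `|d| + 1 by rewrite ltr_wpDl.
have t0 : 0 < t by rewrite divr_gt0.
have td : `|t *: d| < delta.
  rewrite normrZ gtr0_norm// /t mulrAC -mulrA gtr_pMr//.
  by rewrite ltr_pdivrMr// mul1r ltrDl.
have [||Ut] := strict (y + t *: d) y; rewrite ?subrr ?normr0//.
  by rewrite addrC addKr.
rewrite [y + _ - y]addrAC subrr add0r -scalemxAr => est.
have : `|L *m (g (y + t *: d) - g y - t *: (jac g y *m d))|
    <= t * (e / K * (N%:R * `|L| * `|d|)).
  rewrite (le_trans (mx_norm_mulmx _ _))//.
  apply: (le_trans (ler_wpM2l _ est)); first by rewrite mulr_ge0.
  rewrite normrZ (gtr0_norm t0) le_eqVlt; apply/orP; left; apply/eqP.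
  by field; rewrite gt_eqF.
rewrite mulmxBr Ld// -scalemxAr -scalerBr normrZ (gtr0_norm t0).
rewrite ler_pM2l// => /le_trans; apply.
rewrite mulrAC ler_pdivrMr// ler_wpM2l ?(ltW e0)//.
by rewrite lerDl.
Qed.

(** * Kernels and induced matrices *)

Lemma eq_mulmx_cV (R : pzRingType) m n (A B : 'M[R]_(m, n)) :
  (forall z : 'cV[R]_n, A *m z = B *m z) -> A = B.
Proof. 
move=> AB; apply/trmx_inj/row_matrixP => j.
by rewrite -!tr_col !colE AB.
 Qed.

Lemma row_base_mulmx_eq0 (F : fieldType) m n p (A : 'M[F]_(m, n)) (z : 'M[F]_(n, p)) :
  (row_base A *m z == 0) = (A *m z == 0).
Proof.
rewrite -[in RHS](mulmx_base A) -mulmxA.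
by rewrite -[in LHS](inj_eq (row_full_inj (col_base_full A))) mulmx0.
Qed.

Lemma dim_lker_mulmx (F : fieldType) m n (A : 'M[F]_(m, n)) :
  (\dim (lker (linfun (mulmx A) : 'Hom('cV[F]_n, 'cV[F]_m))) + \rank A = n)%N.
Proof.
pose P := row_base A.
pose f : 'Hom('cV[F]_n, 'cV[F]_(\rank A)) := linfun (mulmx P).
have -> : lker (linfun (mulmx A) : 'Hom('cV[F]_n, 'cV[F]_m)) = lker f.
  by apply/vspaceP => y; rewrite !memv_ker !lfunE /= row_base_mulmx_eq0.
have imf : limg f = fullv.
  apply/vspaceP => b; rewrite memvf; apply/memv_imgP.
  exists (pinvmx P *m b); first exact: memvf.
  by rewrite lfunE /= mulmxA mulmxVp ?row_base_free// mul1mx.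
have := limg_ker_dim f fullv.
by rewrite (capv_idPr (subvf _)) imf !dimvf !dim_matrix !mulr1.
Qed.

(** Both sides are the determinant of the block matrix with rows
[t%:M, F] and [P, 1%:M], up to the powers of t: eliminate P in one case and F
in the other. *)
Lemma det_scalar_sub_mulmxC (R : comNzRingType) m n (t : R)
    (F : 'M[R]_(m, n)) (P : 'M[R]_(n, m)) :
  t ^+ n * \det (t%:M - F *m P) = t ^+ m * \det (t%:M - P *m F).
Proof.
pose B := block_mx t%:M F P 1%:M.
have B1 : \det B = \det (t%:M - F *m P).
  rewrite -[LHS]mulr1.
  have <- : \det (block_mx (1%:M : 'M[R]_m) 0 (- P) (1%:M : 'M[R]_n)) = 1.
    by rewrite det_lblock !det1 mulr1.
  rewrite -det_mulmx mulmx_block !mulmx1 !mulmx0 !mulmxN !mul1mx subrr !add0r.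
  by rewrite det_ublock det1 mulr1.
have B2 : \det B * t ^+ n = t ^+ m * \det (t%:M - P *m F).
  have <- : \det (block_mx (1%:M : 'M[R]_m) (- F) 0 (t%:M : 'M[R]_n)) = t ^+ n.
    by rewrite det_ublock det1 det_scalar mul1r.
  rewrite -det_mulmx mulmx_block !mulmx1 !mulmx0 !mulmxN !mul1mx !addr0.
  rewrite mul_scalar_mx mul_mx_scalar addNr det_lblock det_scalar.
  by rewrite addrC.
by rewrite mulrC -B1 B2.
Qed.

Lemma char_poly_add1 (R : comNzRingType) n (F : 'M[R]_n) :
  char_poly (1%:M + F) = \det (('X - 1)%:M - map_mx polyC F).
Proof.
rewrite /char_poly; congr (\det _); apply/matrixP => i j.
by rewrite !mxE polyCD opprD addrA mulrnBl -[1%:P *+ _]polyCMn.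
Qed.

(** A - 1 factors through P, so A and the matrix P A U that it induces on the
quotient by the kernel of P differ from the identity by the two products of
the same pair of rectangular matrices. *)
Lemma char_poly_quotient (R : comNzRingType) m n (A : 'M[R]_n)
    (P : 'M[R]_(m, n)) (U : 'M[R]_(n, m)) :
  P *m U = 1%:M -> (A - 1%:M) *m U *m P = A - 1%:M ->
  ('X - 1) ^+ m * char_poly A = ('X - 1) ^+ n * char_poly (P *m A *m U).
Proof.
move=> PU AUP.
have -> : A = 1%:M + (A - 1%:M) *m U *m P by rewrite AUP addrC subrK.
set F := (A - 1%:M) *m U.
have -> : P *m (1%:M + F *m P) *m U = 1%:M + P *m F.
  by rewrite mulmxDr mulmx1 mulmxDl PU -!mulmxA PU mulmx1.
by rewrite !char_poly_add1 !map_mxM det_scalar_sub_mulmxC.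
Qed.

(** The conservation law says that the left kernel of Lambda consists of left
fixed vectors of A, that is, the column space of A - 1 lies in the column
space of Lambda. Both have the rank of Lambda, so they are equal: a vector z
on which all the invariants vanish has the form (A - 1) w, and applying P
recovers P w, hence z, from P z. *)
Lemma invariants_determined (F : fieldType) n m (Lambda A : 'M[F]_n)
    (P : 'M[F]_(m, n)) (U : 'M[F]_(n, m)) (z : 'cV[F]_n) :
  m = \rank Lambda -> P *m U = 1%:M -> (A - 1%:M) *m U *m P = A - 1%:M ->
  P *m A *m U - 1%:M \in unitmx ->
  (forall c : 'cV[F]_n, c^T *m Lambda = 0 -> c^T *m A = c^T) ->
  (forall c : 'cV[F]_n, c^T *m Lambda = 0 -> c^T *m z = 0) ->
  z = (A - 1%:M) *m U *m invmx (P *m A *m U - 1%:M) *m (P *m z).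
Proof.
move=> mE PU AUP Cunit consA consz.
have CE : P *m (A - 1%:M) *m U = P *m A *m U - 1%:M.
  by rewrite mulmxBr mulmxBl mulmx1 PU.
have sub_Lambda p (X : 'M[F]_(n, p)) :
    (forall c : 'cV[F]_n, c^T *m Lambda = 0 -> c^T *m X = 0) ->
    (X^T <= Lambda^T)%MS.
  move=> consX; rewrite submxE; apply/eqP/trmx_inj; rewrite trmx_mul trmxK trmx0.
  apply/row_matrixP => j; rewrite row_mul row0 -tr_col; apply: consX.
  apply: trmx_inj.
  by rewrite trmx_mul trmxK colE mulmxA mulmx_coker mul0mx trmx0.
have subA : ((A - 1%:M)^T <= Lambda^T)%MS.
  by apply: sub_Lambda => c c0; rewrite mulmxBr mulmx1 consA// subrr.
have rankA : (\rank Lambda^T <= \rank (A - 1%:M)^T)%N.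
  rewrite !mxrank_tr -mE -(mxrank_unit Cunit) -CE.
  by rewrite (leq_trans (mxrankM_maxl _ _))// mxrankM_maxr.
have /andP[_ subL] : ((A - 1%:M)^T == Lambda^T)%MS.
  by rewrite -(geq_leqif (mxrank_leqif_eq subA)).
have /submxP[w /(congr1 trmx)] := submx_trans (sub_Lambda _ _ consz) subL.
rewrite trmxK trmx_mul trmxK; set w' := w^T => zE.
have PzE : P *m z = (P *m A *m U - 1%:M) *m (P *m w').
  by rewrite zE -CE -[in LHS]AUP !mulmxA.
by rewrite PzE mulmxA mulmxKV// mulmxA AUP.
Qed.

(** * A norm contracted by a matrix of small spectral radius *)

(** The matrix M acts on the chain x, (M - z_1) x, (M - z_2) (M - z_1) x, ...
by M x_i = z_i x_i + x_(i+1). This seminorm is the sum of the norms of the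
members of the chain, weighted by c ^+ i, so that for c large the off-diagonal
part of that action has small weight. *)
Fixpoint chain_norm (K : numFieldType) m (c : K) (M : 'M[K]_m) (s : seq K)
    (x : 'cV[K]_m) : K :=
  if s is z :: s' then `|x| + c * chain_norm c M s' ((M - z%:M) *m x) else 0.

Definition chain_end (K : numFieldType) m (M : 'M[K]_m) (s : seq K)
    (x : 'cV[K]_m) : 'cV[K]_m :=
  foldl (fun y z => (M - z%:M) *m y) x s.

Section chain_norm.
Context (K : numFieldType) (m : nat) (c : K) (M : 'M[K]_m).
Hypothesis c_gt0 : 0 < c.
Implicit Types (s : seq K) (x y : 'cV[K]_m).

Lemma chain_norm_ge0 s x : 0 <= chain_norm c M s x.
Proof.
elim: s x => //= z s IHs x.
by rewrite addr_ge0// mulr_ge0// ltW.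
Qed.

Lemma chain_normD s x y :
  chain_norm c M s (x + y) <= chain_norm c M s x + chain_norm c M s y.
Proof.
elim: s x y => [|z s IHs] x y /=; first by rewrite addr0.
rewrite mulmxDr addrACA lerD ?ler_normD// -mulrDr ler_wpM2l//.
exact: ltW.
Qed.

Lemma chain_norm_le_mx_norm s :
  exists2 B : K, 0 <= B & forall x, chain_norm c M s x <= B * `|x|.
Proof.
elim: s => [|z s [B B0 IHs]]; first by exists 0 => // x; rewrite mul0r.
exists (1 + c * (B * (m%:R * `|M - z%:M|))).
  by rewrite addr_ge0// !mulr_ge0// ltW.
move=> x /=; rewrite mulrDl mul1r lerD2l -!mulrA ler_wpM2l ?(ltW c_gt0)//.
by rewrite (le_trans (IHs _))// ler_wpM2l// mulrA mx_norm_mulmx.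
Qed.

Lemma mx_norm_le_chain_norm s x :
  chain_end M s x = 0 -> `|x| <= chain_norm c M s x.
Proof.
case: s => [/= ->|z s _ /=]; first by rewrite normr0.
by rewrite lerDl mulr_ge0 ?chain_norm_ge0// ltW.
Qed.

(** The subtracted term is what makes the induction go through: it absorbs the
contribution of x_(i+1) to the image of x_i. *)
Lemma chain_norm_mulmx_strong theta s x :
  {in s, forall z, `|z| <= theta} -> chain_end M s x = 0 ->
  chain_norm c M s (M *m x)
    <= (theta + c^-1) * chain_norm c M s x - c^-1 * `|x|.
Proof.
elim: s x => [|z s IHs] x; first by move=> _ /= ->; rewrite normr0 !mulr0 subr0.
move=> sle /= x0; set y := (M - z%:M) *m x.
have -> : (M - z%:M) *m (M *m x) = M *m y.
  by rewrite /y [RHS]mulmxA [LHS]mulmxA mulmxBl mulmxBr scalar_mxC.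
have {}IHs : chain_norm c M s (M *m y)
    <= (theta + c^-1) * chain_norm c M s y - c^-1 * `|y|.
  by apply: IHs => // z' z's; rewrite sle// in_cons z's orbT.
have Mx : `|M *m x| <= theta * `|x| + `|y|.
  have -> : M *m x = z *: x + y by rewrite /y mulmxBl mul_scalar_mx subrKC.
  rewrite (le_trans (ler_normD _ _))// lerD2r normrZ ler_wpM2r//.
  by rewrite sle// mem_head.
have /(lerD Mx) := ler_wpM2l (ltW c_gt0) IHs.
move=> /le_trans; apply; rewrite le_eqVlt; apply/orP; left; apply/eqP.
by field; rewrite gt_eqF.
Qed.

Lemma chain_norm_mulmx theta s x :
  {in s, forall z, `|z| <= theta} -> chain_end M s x = 0 ->
  chain_norm c M s (M *m x) <= (theta + c^-1) * chain_norm c M s x.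
Proof.
move=> sle x0; apply: (le_trans (chain_norm_mulmx_strong sle x0)).
by rewrite gerBl mulr_ge0// invr_ge0 ltW.
Qed.

End chain_norm.

Lemma chain_end_horner (K : numFieldType) n (M : 'M[K]_n.+1) (s : seq K)
    (x : 'cV[K]_n.+1) :
  chain_end M s x = horner_mx M (\prod_(z <- s) ('X - z%:P)) *m x.
Proof.
rewrite /chain_end; elim: s x => [|z s IHs] x /=.
  by rewrite big_nil rmorph1 mul1mx.
rewrite IHs big_cons mulrC rmorphM /= -mulmxA; congr (_ *m (_ *m _)).
by rewrite rmorphB /= horner_mx_X horner_mx_C.
Qed.

Lemma chain_end_char_poly (K : numFieldType) m (M : 'M[K]_m) (s : seq K)
    (x : 'cV[K]_m) :
  char_poly M = \prod_(z <- s) ('X - z%:P) -> chain_end M s x = 0.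
Proof.
case: m M x => [|n] M x Ms; first exact: flatmx0.
by rewrite chain_end_horner -Ms Cayley_Hamilton mul0mx.
Qed.

Lemma uniform_bound_lt1 (R : realType) (s : seq R[i]) :
  {in s, forall z, `|z| < 1} ->
  exists theta : R, [/\ 0 <= theta, theta < 1 &
    {in s, forall z, `|z| <= theta%:C%C}].
Proof.
elim: s => [|z s IHs] s1; first by exists 0.
have [|th [th0 th1 sth]] := IHs.
  by move=> w ws; rewrite s1 ?in_cons ?ws ?orbT.
have z1 : `|z| < 1 by rewrite s1 ?mem_head.
rewrite normc_def -(rmorph1 (real_complex R)) ltcR in z1.
exists (Num.max th (Num.sqrt (complex.Re z ^+ 2 + complex.Im z ^+ 2))); split.
- by rewrite le_max th0.
- by rewrite gt_max th1.
- move=> w; rewrite in_cons => /orP[/eqP->|/sth wth].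
    by rewrite normc_def lecR le_max lexx orbT.
  by rewrite (le_trans wth)// lecR le_max lexx.
Qed.

(** The chain norm is complex-valued, but nonnegative, hence its own real
part; restricted to real vectors it gives a norm for which C is a strict
contraction. *)
Lemma contracting_norm (R : realType) m (C : 'M[R]_m) (s : seq R[i]) :
  is_spectrum C s -> {in s, forall z, `|z| < 1} ->
  exists (nu : 'cV[R]_m -> R) (rho B : R),
  [/\ [/\ 0 <= rho, rho < 1 & 0 <= B],
      forall x, `|x| <= nu x,
      forall x, nu x <= B * `|x|,
      forall x y, nu (x + y) <= nu x + nu y &
      forall x, nu (C *m x) <= rho * nu x].
Proof.
move=> Cs /uniform_bound_lt1[th [th0 th1 sth]].
pose iota := real_complex R.
pose M := map_mx iota C.
(* with this weight the contraction rate th + c^-1 is midway from th to 1 *)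
pose c := 2 / (1 - th); have c0 : 0 < c by rewrite divr_gt0// subr_gt0.
have iotac0 : 0 < iota c by rewrite ltcR.
have leR a b : (a <= b) = (iota a <= iota b) by rewrite lecR.
pose nuC (x : 'cV[R]_m) := chain_norm (iota c) M s (map_mx iota x).
pose nu x := complex.Re (nuC x).
have nuE x : nuC x = iota (nu x).
  by rewrite [RHS]RRe_real// ger0_real// chain_norm_ge0.
have iotaM a b : iota (a * b) = iota a * iota b by exact: rmorphM.
have iotaD a b : iota (a + b) = iota a + iota b by exact: rmorphD.
have iotaV a : iota a^-1 = (iota a)^-1 by exact: fmorphV.
have iota_norm (x : 'cV[R]_m) : `|map_mx iota x| = iota `|x|.
  have iotaE (a : R) : `|iota a| = iota `|a|.
    by rewrite normc_def /= expr0n addr0 sqrtr_sqr.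
  apply/eqP; rewrite eq_le; apply/andP; split.
    apply: mx_norm_ler => [|i j]; first by rewrite ler0c.
    by rewrite mxE iotaE lecR ler_entry_mx_norm.
  rewrite -[leRHS]RRe_real ?ger0_real// lecR.
  apply: mx_norm_ler => [|i j]; first by rewrite -ler0c RRe_real ?ger0_real.
  rewrite -lecR RRe_real ?ger0_real// -[leLHS]iotaE.
  by have := ler_entry_mx_norm (map_mx iota x) i j; rewrite mxE.
have end0 x : chain_end M s x = 0 by exact: chain_end_char_poly.
have [B B0 nuB] := chain_norm_le_mx_norm M iotac0 s.
exists nu, (th + c^-1), (complex.Re B); split.
- split.
  + by rewrite addr_ge0// invr_ge0 ltW.
  + by rewrite /c invf_div; lra.
  + by rewrite -ler0c RRe_real// ger0_real.
- move=> x; rewrite leR -iota_norm -nuE.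
  exact: mx_norm_le_chain_norm.
- move=> x; rewrite leR iotaM -nuE -iota_norm.
  have -> : iota (complex.Re B) = B by rewrite [LHS]RRe_real// ger0_real.
  exact: nuB.
- move=> x y; rewrite leR iotaD -!nuE /nuC map_mxD.
  exact: chain_normD.
- move=> x; rewrite leR iotaM -!nuE /nuC map_mxM iotaD.
  by rewrite iotaV; apply: (chain_norm_mulmx iotac0 sth (end0 _)).
Qed.

(** Cancel (X - 1) ^+ n in the identity between the characteristic polynomials
of A and of the induced matrix: as n = k + m, the k eigenvalues 1 of A that
belong to the kernel of P disappear. *)
Lemma spectrum_quotient (R : realType) m n k (A : 'M[R]_n) (P : 'M[R]_(m, n))
    (U : 'M[R]_(n, m)) (s : seq R[i]) :
  P *m U = 1%:M -> (A - 1%:M) *m U *m P = A - 1%:M -> n = (k + m)%N ->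
  is_spectrum A (nseq k 1 ++ s) -> is_spectrum (P *m A *m U) s.
Proof.
rewrite /is_spectrum => PU AUP nE; rewrite big_cat /= big_nseq => As.
pose iota := real_complex R.
have := @char_poly_quotient _ m n (map_mx iota A) (map_mx iota P) (map_mx iota U).
rewrite -!map_mxM PU map_mx1 => /(_ erefl).
rewrite -(map_mx1 iota) -map_mxB -!map_mxM AUP => /(_ erefl).
have -> : ('X - 1 : {poly R[i]}) ^+ n = ('X - 1) ^+ k * ('X - 1) ^+ m.
  by rewrite nE exprD.
rewrite As mulrCA -mulrA.
have -> : iter k ( *%R ('X - 1%:P : {poly R[i]})) 1 = ('X - 1) ^+ k.
  by rewrite iter_mulr_1.
have X0 l : ('X - 1 : {poly R[i]}) ^+ l != 0.
  by rewrite expf_neq0// -polyC1 polyXsubC_eq0.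
by move=> /(mulfI (X0 _))/(mulfI (X0 _)) ->.
Qed.

(** A fixed vector of C vanishes because C is a strict contraction for a
suitable norm. *)
Lemma spectrum_lt1_sub1_unitmx (R : realType) m (C : 'M[R]_m) (s : seq R[i]) :
  is_spectrum C s -> {in s, forall z, `|z| < 1} -> C - 1%:M \in unitmx.
Proof.
move=> Cs s1.
have [nu [rho [B [[_ rho1 _] nu_ge _ _ nuC]]]] := contracting_norm Cs s1.
rewrite -unitmx_tr -row_free_unit; apply: inj_row_free => v.
move/(congr1 trmx); rewrite trmx_mul trmxK trmx0 mulmxBl mul1mx => /eqP.
rewrite subr_eq0 => /eqP Cv; apply: trmx_inj; rewrite trmx0.
have := nuC v^T; rewrite Cv => nuv.
have nuv0 : nu v^T <= 0.
  by rewrite -(@pmulr_rle0 _ (1 - rho)) ?subr_gt0// mulrBl mul1r subr_le0.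
by apply/eqP; rewrite -normr_le0 (le_trans (nu_ge _)).
Qed.

(** * Orbits near a subspace of fixed points *)

(** The weight of mu is chosen so that the total drift of the orbit, at most
c * mu z * (1 + rho + rho ^+ 2 + ...), is paid for in advance: the quantity
[|z| + c / (1 - rho) * mu z] does not increase along an orbit, which therefore
never leaves the ball where the two estimates are available. *)
Lemma orbit_bound (R : realFieldType) (V : normedZmodType R) (f : V -> V)
    (mu : V -> R) (rho c delta : R) :
  0 <= rho -> rho < 1 -> 0 <= c -> (forall z, 0 <= mu z) ->
  (forall z, `|z| < delta -> mu (f z) <= rho * mu z /\ `|f z - z| <= c * mu z) ->
  forall z0, `|z0| + c / (1 - rho) * mu z0 < delta -> forall n,
    `|iter n f z0| <= `|z0| + c / (1 - rho) * mu z0 /\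
    mu (iter n f z0) <= rho ^+ n * mu z0.
Proof.
move=> rho0 rho1 c0 mu0 step z0 z0d.
have w0 : 0 <= c / (1 - rho) by rewrite divr_ge0// subr_ge0 ltW.
suff orb n : `|iter n f z0| + c / (1 - rho) * mu (iter n f z0)
      <= `|z0| + c / (1 - rho) * mu z0 /\ mu (iter n f z0) <= rho ^+ n * mu z0.
  move=> n; have [le1 le2] := orb n; split=> //.
  by rewrite (le_trans _ le1)// lerDl mulr_ge0.
elim: n => [|n [IH1 IH2]]; first by rewrite expr0 mul1r.
rewrite iterS; set z := iter n f z0 in IH1 IH2 *.
have zd : `|z| < delta.
  by rewrite (le_lt_trans _ z0d)// (le_trans _ IH1)// lerDl mulr_ge0.
have [muf df] := step z zd.
split; last by rewrite (le_trans muf)// exprS -[leRHS]mulrA ler_wpM2l.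
apply: le_trans IH1.
have -> : c / (1 - rho) * mu z = c * mu z + c / (1 - rho) * (rho * mu z).
  by field; rewrite gt_eqF// subr_gt0.
rewrite addrA lerD ?ler_wpM2l//.
by rewrite -[f z](subrKC z) (le_trans (ler_normD _ _))// lerD2l.
Qed.

(** Replacing z by its component z - U P z in the kernel of P leads to another
fixed point, so that g (ystar + z) - ystar differs from z by
(A - 1) U P z up to an error that is small compared with P z, and not merely
with z. Hence P z is contracted, and the displacement of z is controlled by
P z. *)
Lemma quotient_contraction (R : realType) N m (g : 'cV[R]_N -> 'cV[R]_N)
    (ystar : 'cV[R]_N) (DD : set 'cV[R]_N) (P : 'M[R]_(m, N))
    (U : 'M[R]_(N, m)) (s : seq R[i]) (f := fun z => g (ystar + z) - ystar) :
  open_nbhs ystar DD -> C1_on DD g -> P *m U = 1%:M ->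
  (forall z, P *m z = 0 -> DD (ystar + z) -> g (ystar + z) = ystar + z) ->
  is_spectrum (P *m jac g ystar *m U) s -> {in s, forall z, `|z| < 1} ->
  exists (mu : 'cV[R]_N -> R) (rho c B delta : R),
  [/\ [/\ 0 <= rho, rho < 1, 0 <= c, 0 <= B & 0 < delta],
      forall z, `|P *m z| <= mu z,
      forall z, mu z <= B * `|z| &
      forall z, `|z| < delta -> mu (f z) <= rho * mu z /\ `|f z - z| <= c * mu z].
Proof.
move=> DDy gC1 PU gfix Cs s1; set A := jac g ystar in Cs *.
have [nu [rho [B [[rho0 rho1 B0] nu_ge nu_le nuD nuC]]]] := contracting_norm Cs s1.
pose kU := m%:R * `|U|; pose kP := N%:R * `|P|; pose kA := N%:R * `|A - 1%:M|.
have kU0 : 0 <= kU by rewrite mulr_ge0.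
have kP0 : 0 <= kP by rewrite mulr_ge0.
have kA0 : 0 <= kA by rewrite mulr_ge0.
have leU (b : 'cV[R]_m) : `|U *m b| <= kU * `|b| by exact: mx_norm_mulmx.
have leP (z : 'cV[R]_N) : `|P *m z| <= kP * `|z| by exact: mx_norm_mulmx.
have leA (z : 'cV[R]_N) : `|(A - 1%:M) *m z| <= kA * `|z| by exact: mx_norm_mulmx.
pose Q := B * kP * kU + 1.
have Q0 : 0 < Q by rewrite ltr_wpDl// !mulr_ge0.
(* an error of relative size eps raises the contraction rate from rho to at
   most (1 + rho) / 2 *)
pose eps := (1 - rho) / 2 / Q.
have eps0 : 0 < eps by rewrite !divr_gt0// subr_gt0.
have [d d0 strict] := C1_strictly_differentiable DDy gC1 eps0.
pose kp := 1 + kU * kP.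
have kp1 : 1 <= kp by rewrite lerDl mulr_ge0.
have kp0 : 0 < kp by rewrite (lt_le_trans ltr01).
exists (fun z => nu (P *m z)), ((1 + rho) / 2), (kA * kU + eps * kU), (B * kP), (d / kp).
split.
- split; [lra|lra| |exact: mulr_ge0|exact: divr_gt0].
  by rewrite addr_ge0// mulr_ge0// ltW.
- by move=> z; exact: nu_ge.
- by move=> z; rewrite (le_trans (nu_le _))// -[leRHS]mulrA ler_wpM2l.
move=> z; rewrite ltr_pdivlMr// mulrC => zd.
set b := P *m z; pose p := z - U *m b.
have nub0 : 0 <= nu b by rewrite (le_trans _ (nu_ge b)).
have Pp : P *m p = 0 by rewrite mulmxBr mulmxA PU mul1mx subrr.
have pd : `|p| < d.
  rewrite (le_lt_trans _ zd)// /p (le_trans (ler_normB _ _))//.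
  rewrite mulrDl mul1r lerD2l (le_trans (leU _))// -[leRHS]mulrA ler_wpM2l//.
  exact: leP.
have {}zd : `|z| < d by rewrite (le_lt_trans _ zd)// ler_peMl.
have shift x : ystar + x - ystar = x by rewrite addrAC subrr add0r.
have zd' : `|ystar + z - ystar| < d by rewrite shift.
have pd' : `|ystar + p - ystar| < d by rewrite shift.
have [DDp _] := strict _ _ pd' pd'; have [_] := strict _ _ zd' pd'.
rewrite (gfix p)// opprD addrA -/A.
have -> : ystar + z + (- ystar - p) = U *m b by rewrite addrA shift /p opprB subrKC.
set e := (X in `|X| <= _) => est.
have {}est : `|e| <= eps * kU * nu b.
  rewrite (le_trans est)// -[leRHS]mulrA ler_wpM2l ?(ltW eps0)//.
  by rewrite (le_trans (leU _))// ler_wpM2l.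
have fzE : f z = z + (A - 1%:M) *m (U *m b) + e.
  rewrite /f /e /p mulmxBl mul1mx.
  move: (A *m (U *m b)) (U *m b) (g (ystar + z)) => a1 a2 a3.
  by apply/matrixP => i j; rewrite !mxE; ring.
have PfzE : P *m f z = P *m A *m U *m b + P *m e.
  rewrite fzE !mulmxDr mulmxBl mul1mx mulmxBr !mulmxA PU mul1mx.
  by rewrite -/b subrKC.
split.
  rewrite PfzE (le_trans (nuD _ _))//.
  have nue : nu (P *m e) <= (1 - rho) / 2 * nu b.
    rewrite (le_trans (nu_le _))//.
    rewrite (le_trans (ler_wpM2l B0 (leP _)))//.
    rewrite (le_trans (ler_wpM2l B0 (ler_wpM2l kP0 est)))//.
    have -> : B * (kP * (eps * kU * nu b))
        = (1 - rho) / 2 * nu b * (B * kP * kU / Q).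
      by rewrite /eps; field; rewrite gt_eqF.
    rewrite ler_piMr//; first by rewrite mulr_ge0// divr_ge0// subr_ge0 ltW.
    by rewrite ler_pdivrMr// mul1r lerDl.
  have := nuC b; lra.
rewrite fzE -[z + _ + e]addrA addrAC subrr add0r.
rewrite (le_trans (ler_normD _ _))// mulrDl lerD//.
by rewrite (le_trans (leA _))// -[leRHS]mulrA ler_wpM2l// (le_trans (leU _))// ler_wpM2l.
Qed.

(** * Stability and convergence *)

Lemma mx_of_rows_mulmxP (R : realType) N k p (n : k.-tuple 'cV[R]_N)
    (a b : 'M[R]_(N, p)) :
  mx_of_rows n *m a = mx_of_rows n *m b <->
  forall i, (tnth n i)^T *m a = (tnth n i)^T *m b.
Proof.
split=> [nab i|nab]; last first.
  by apply/row_matrixP => i; rewrite !row_mul rowK.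
by rewrite -[(tnth n i)^T](rowK (fun i => (tnth n i)^T)) -!row_mul nab.
Qed.

Lemma mem_mxker_tr (R : realType) m n (A : 'M[R]_(m, n)) (c : 'cV[R]_m) :
  (c \in mxker A^T) = (c^T *m A == 0).
Proof. by rewrite mem_mxker -(inj_eq trmx_inj) trmx_mul trmxK trmx0. Qed.

Lemma iter_translate (V : zmodType) (g : V -> V) (y z : V) n :
  iter n g z - y = iter n (fun x => g (y + x) - y) (z - y).
Proof. by elim: n => //= n <-; rewrite subrKC. Qed.

Theorem theorem5p4 (R : realType) (N k : nat) (nrm : 'cV[R]_N -> R)
    (Lambda : 'M[R]_N) (v : k.-tuple 'cV[R]_N)
    (D DD : set 'cV[R]_N) (g : 'cV[R]_N -> 'cV[R]_N) (ystar : 'cV[R]_N)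
    (nrmP : is_norm nrm)
    (k_gt0 : (0 < k)%N)
    (ker_span : mxker Lambda = <<v>>%VS)
    (ker_dim : \dim (mxker Lambda) = k)
    (ystar_ker : ystar \in mxker Lambda)
    (ystar_fixed : g ystar = ystar)
    (gD : set_fun D D g)
    (DD_nbhs : open_nbhs ystar DD)
    (DD_sub : DD `<=` D)
    (ker_fixed : forall y, y \in mxker Lambda -> DD y -> g y = y)
    (g_C1 : C1_on DD g)
    (g_lip : [lipschitz jac g y | y in DD]) :
  (forall i : 'I_k, jac g ystar *m tnth v i = tnth v i) /\
  (* (a) *)
  (remaining_eigenvalues_lt1 k (jac g ystar) ->
    stable_fixed_point nrm D g ystar) /\
  (* (b) *)
  (forall n : k.-tuple 'cV[R]_N, basis_of (mxker Lambda^T) n ->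
    conserves_linear_invariants Lambda D g ->
    (forall y, (invariant_set n ystar `&` D) y ->
      (invariant_set n ystar `&` D) (g y)) /\
    (remaining_eigenvalues_lt1 k (jac g ystar) ->
      exists2 delta : R, 0 < delta &
        forall y0, (invariant_set n ystar `&` D) y0 ->
          nrm (y0 - ystar) < delta ->
          iter m g y0 @[m --> \oo] --> ystar)).
Proof.
set A := jac g ystar.
have A_ker x : x \in mxker Lambda -> A *m x = x.
  move=> xker; have := @jac_invariant_direction R N N DD g ystar x 1%:M.
  rewrite !mul1mx; apply=> // t yt; rewrite !mul1mx.
  rewrite ystar_fixed ker_fixed//; first by rewrite addrAC subrr add0r.
  by rewrite memvD// memvZ.
have DDy : DD ystar by case: DD_nbhs.
have [P [U [PU kerP]]] : exists (P : 'M[R]_(\rank Lambda, N)) U,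
    P *m U = 1%:M /\ forall z, P *m z = 0 -> z \in mxker Lambda.
  exists (row_base Lambda), (pinvmx (row_base Lambda)); split.
    by rewrite mulmxVp// row_base_free.
  by move=> z /eqP; rewrite row_base_mulmx_eq0 mem_mxker.
have AUP : (A - 1%:M) *m U *m P = A - 1%:M.
  apply: eq_mulmx_cV => z; apply/eqP; rewrite -subr_eq0 -!mulmxA -mulmxBr.
  rewrite mulmxBl mul1mx A_ker ?subrr//; apply: kerP.
  by rewrite mulmxBr !mulmxA PU mul1mx subrr.
have N_dim : N = (k + \rank Lambda)%N.
  by rewrite -ker_dim -[LHS](dim_lker_mulmx Lambda).
have P_fixed z : P *m z = 0 -> DD (ystar + z) -> g (ystar + z) = ystar + z.
  by move=> /kerP zker; apply: ker_fixed; rewrite memvD.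
pose f z := g (ystar + z) - ystar.
have [K1 K10 nrm_le] := is_norm_le_mx_norm nrmP.
have [K2 K20 le_nrm] := mx_norm_le_is_norm nrmP.
have dynamics : remaining_eigenvalues_lt1 k A ->
    P *m A *m U - 1%:M \in unitmx /\
    forall eps : R, 0 < eps -> exists2 delta : R, 0 < delta &
      forall z0, nrm z0 < delta ->
        (forall n, nrm (iter n f z0) < eps) /\
        exists rho M : R, [/\ 0 <= rho, rho < 1 &
          forall n, `|P *m iter n f z0| <= M * rho ^+ n].
  move=> [s As s1].
  have Cs := spectrum_quotient PU AUP N_dim As.
  split; first exact: spectrum_lt1_sub1_unitmx Cs s1.
  move=> eps eps0.
  have [mu [rho [c [B [d [[rho0 rho1 c0 B0 d0] mu_ge mu_le step]]]]]] :=
    quotient_contraction DD_nbhs g_C1 PU P_fixed Cs s1.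
  pose w := c / (1 - rho).
  have w0 : 0 <= w by rewrite divr_ge0// subr_ge0 ltW.
  (* Q * nrm z0 bounds the quantity that does not increase along the orbit *)
  pose Q := (1 + w * B) * K2.
  have Q0 : 0 < Q by rewrite mulr_gt0// ltr_wpDr// mulr_ge0.
  exists (Num.min d (eps / K1) / Q).
    by rewrite divr_gt0// lt_min d0 divr_gt0.
  move=> z0; rewrite ltr_pdivlMr// lt_min => /andP[z0d z0eps].
  have z0Q : `|z0| + w * mu z0 <= nrm z0 * Q.
    rewrite (@le_trans _ _ ((1 + w * B) * `|z0|))//.
      by rewrite mulrDl mul1r lerD2l -mulrA ler_wpM2l.
    by rewrite mulrCA [nrm _ * _]mulrC ler_wpM2l// addr_ge0// mulr_ge0.
  have mu0 z : 0 <= mu z by rewrite (le_trans _ (mu_ge z)).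
  have orb := orbit_bound rho0 rho1 c0 mu0 step (le_lt_trans z0Q z0d).
  split=> [n|].
    rewrite (le_lt_trans (nrm_le _))// mulrC -ltr_pdivlMr//.
    by rewrite (le_lt_trans (orb n).1)// (le_lt_trans z0Q).
  exists rho, (mu z0); split=> // n.
  by rewrite (le_trans (mu_ge _))// mulrC (orb n).2.
split; first by move=> i; rewrite A_ker// ker_span memv_span// mem_tnth.
split=> [/dynamics[_ dyn]|n n_basis cons].
  split=> // eps /dyn[delta delta0 orb].
  by exists delta => // y0 _ y0d m; rewrite iter_translate; exact: (orb _ y0d).1.
have H_invariant y : (invariant_set n ystar `&` D) y ->
    (invariant_set n ystar `&` D) (g y).
  move=> [Hy Dy]; split; last exact: gD.
  rewrite /invariant_set /= -Hy; apply/mx_of_rows_mulmxP => i.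
  apply: cons => //; apply/eqP; rewrite -mem_mxker_tr.
  by rewrite (basis_mem n_basis)// mem_tnth.
split=> // /dynamics[Cunit /(_ 1 ltr01)[delta delta0 orb]].
exists delta => // y0 Hy0 y0d.
have consA (c : 'cV[R]_N) : c^T *m Lambda = 0 -> c^T *m A = c^T.
  move=> c0; apply: eq_mulmx_cV => d; rewrite -mulmxA.
  apply: (jac_invariant_direction DD_nbhs g_C1) => t yt.
  rewrite mulmxBr !(cons _ c0) ?mulmxDr; [|exact: DD_sub..].
  by rewrite addrAC subrr add0r -scalemxAr.
pose Y := (A - 1%:M) *m U *m invmx (P *m A *m U - 1%:M).
have zY m : iter m f (y0 - ystar) = Y *m (P *m iter m f (y0 - ystar)).
  apply: (@invariants_determined _ _ _ Lambda) => // c /eqP c0.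
  rewrite -iter_translate mulmxBr; apply/eqP; rewrite subr_eq0; apply/eqP.
  have [Hm _] : (invariant_set n ystar `&` D) (iter m g y0).
    by elim: m => //= m; exact: H_invariant.
  have : c \in <<n>>%VS by rewrite (span_basis n_basis) mem_mxker_tr.
  move=> /coord_span ->; rewrite linear_sum /= !mulmx_suml.
  apply: eq_bigr => i _; rewrite linearZ /= -!scalemxAl; congr (_ *: _).
  rewrite -tnth_nth; exact: (mx_of_rows_mulmxP _ _ _).1.
have [_ [rho [M [rho0 rho1 geo]]]] := orb _ y0d.
apply/cvgrPdist_le => e e0.
have /cvgrPdist_le/(_ e e0) :
    geometric ((\rank Lambda)%:R * `|Y| * M) rho x @[x --> \oo] --> (0 : R).
  by apply: cvg_geometric; rewrite ger0_norm.
apply: filterS => m; rewrite sub0r normrN /= => gm.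
rewrite distrC iter_translate zY (le_trans (mx_norm_mulmx _ _))//.
apply: le_trans gm; apply: le_trans (ler_norm _).
by rewrite -[leRHS]mulrA ler_wpM2l// mulr_ge0.
Qed.
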